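(* Let $F$ be a perfect field of characteristic $2$ and let $K=F((t))$ be the field of formal Laurent series over $F$. Let $\pi$ and $\pi'$ be anisotropic $2$-fold Pfister forms over $K$. If $\pi$ and $\pi'$ are totally separably linked, then $\pi\simeq\pi'$ (i.e. $\pi$ and $\pi'$ are isometric).
   Context: For $a\in K$, $[1,a]$ denotes the quadratic form $(x,y)\mapsto x^2+xy+ay^2$ on $K^2$. A $2$-fold Pfister form over $K$ is a quadratic form isometric to $\langle\langle b,a]] := [1,a]\perp b[1,a]$ with $a\in K$, $b\in K^\times$. A quadratic form $(V,q)$ is anisotropic if $q(x)\neq 0$ for all $x\ne 0$; it is hyperbolic if it is isometric to an orthogonal sum of copies of the hyperbolic plane $(x,y)\mapsto xy$. $\pi_L$ denotes the scalar extension of $\pi$ to a field extension $L/K$. $\pi$ and $\pi'$ are totally separably linked if for every separable quadratic field extension $L/K$, $\pi_L$ is hyperbolic if and only if $\pi'_L$ is hyperbolic. *)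

(* Defs.v *)
From HB Require Import structures.
From mathcomp Require Import all_boot all_order all_algebra all_field.
From mathcomp Require Import boolp classical_sets functions cardinality fsbigop.
From mathcomp Require Import ring zify.

Set Implicit Arguments.
Unset Strict Implicit.
Unset Printing Implicit Defensive.

Import Order.TTheory GRing.Theory Num.Theory.
Local Open Scope ring_scope.

(* Formal Laurent series: coefficient families indexed by the integers that
   vanish below some index, with the Cauchy product. *)

Definition bounded_below (F : fieldType) (f : int -> F) : bool :=
  `[< exists N : int, forall i : int, i < N -> f i = 0 >].

Record laurent (F : fieldType) := Laurent {
  lcoef :> int -> F;
  lcoef_bounded : bounded_below lcoef }.

Section LaurentField.
Variable F : fieldType.
Implicit Types f g h : laurent F.

HB.instance Definition _ := [isSub for @lcoef F].
HB.instance Definition _ := [Choice of laurent F by <:].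

Lemma laurentP f g : (forall i, f i = g i) -> f = g.
Proof. by move=> fg; apply/val_inj/funext. Qed.

Lemma laurent_ltP f : exists N : int, forall i, i < N -> f i = 0.
Proof. by case: f => f /= /asboolP. Qed.

(* Common bound, shifted to a negative integer. *)
Lemma laurent_bound f : exists a : nat, forall b : nat, (a <= b)%N ->
  forall i : int, i < - b%:Z -> f i = 0.
Proof.
have [N fN] := laurent_ltP f; exists `|N|%N => b ab i ib.
by apply: fN; lia.
Qed.

Lemma bounded_below0 : bounded_below (fun=> 0 : F).
Proof. by apply/asboolP; exists 0. Qed.

Lemma bounded_below1 : bounded_below (fun i : int => (i == 0)%:R : F).
Proof. by apply/asboolP; exists 0 => i i0; rewrite lt_eqF. Qed.

Lemma bounded_belowN f : bounded_below (fun i => - f i).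
Proof.
have [N fN] := laurent_ltP f.
by apply/asboolP; exists N => i /fN ->; rewrite oppr0.
Qed.

Lemma bounded_belowD f g : bounded_below (fun i => f i + g i).
Proof.
have [a fa] := laurent_bound f; have [b gb] := laurent_bound g.
apply/asboolP; exists (- (maxn a b)%:Z) => i iab.
by rewrite (fa _ (leq_maxl a b)) // (gb _ (leq_maxr a b)) // addr0.
Qed.

(* The sum has finite support, so the finitely supported big sum is the
   genuine Cauchy coefficient; see [conv_coefE]. *)
Definition conv_coef (f g : int -> F) (n : int) : F :=
  \sum_(i \in [set: int]) f i * g (n - i).

Lemma conv_coefE f g (a b c : nat) (n : int) :
    (forall i : int, i < - a%:Z -> f i = 0) ->
    (forall i : int, i < - b%:Z -> g i = 0) -> n + a%:Z + b%:Z < c%:Z ->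
  conv_coef f g n = \sum_(k < c) f (k%:Z - a%:Z) * g (n - (k%:Z - a%:Z)).
Proof.
move=> fa gb nc.
pose s := [seq (k%:Z - a%:Z : int) | k <- index_iota 0 c].
have us : uniq s by rewrite map_inj_uniq ?iota_uniq // => x y; lia.
rewrite /conv_coef -(fsbig_widen [set` s]) //; last first.
  move=> i [_ /= si].
  have [ia|ai] := ltP i (- a%:Z); first by rewrite fa // mul0r.
  have [ic|ci] := ltP i (c%:Z - a%:Z); last by rewrite gb ?mulr0 //; lia.
  case: si; apply/mapP; exists (absz ((i : int) + a%:Z)); last by lia.
  by rewrite mem_index_iota; lia.
rewrite -fsbig_seq // /s big_map big_mkord.
by apply: eq_bigr.
Qed.

Lemma bounded_below_conv f g : bounded_below (conv_coef f g).
Proof.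
have [a fa] := laurent_bound f; have [b gb] := laurent_bound g.
apply/asboolP; exists (- (a + b)%:Z) => n nab.
rewrite (conv_coefE (c := 0) (fa _ (leqnn a)) (gb _ (leqnn b))) ?big_ord0 //.
lia.
Qed.

Definition laurent0 := Laurent bounded_below0.
Definition laurent1 := Laurent bounded_below1.
Definition laurent_opp f := Laurent (bounded_belowN f).
Definition laurent_add f g := Laurent (bounded_belowD f g).
Definition laurent_mul f g := Laurent (bounded_below_conv f g).

Lemma laurent_addA : associative laurent_add.
Proof. by move=> f g h; apply: laurentP => i /=; rewrite addrA. Qed.

Lemma laurent_addC : commutative laurent_add.
Proof. by move=> f g; apply: laurentP => i /=; rewrite addrC. Qed.

Lemma laurent_add0 : left_id laurent0 laurent_add.
Proof. by move=> f; apply: laurentP => i /=; rewrite add0r. Qed.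

Lemma laurent_addN : left_inverse laurent0 laurent_opp laurent_add.
Proof. by move=> f; apply: laurentP => i /=; rewrite addNr. Qed.

HB.instance Definition _ := GRing.isZmodule.Build (laurent F)
  laurent_addA laurent_addC laurent_add0 laurent_addN.

Lemma laurent_mulC : commutative laurent_mul.
Proof.
move=> f g; apply: laurentP => n /=; rewrite /conv_coef.
rewrite (reindex_fsbigT (fun i : int => n - i)); last first.
  by exists (fun i : int => n - i) => i; rewrite subKr.
by apply: eq_fsbigr => i _; rewrite subKr mulrC.
Qed.

Lemma laurent_mulCA f g h :
  laurent_mul f (laurent_mul g h) = laurent_mul g (laurent_mul f h).
Proof.
apply: laurentP => n.
have [a fa] := laurent_bound f; have [b gb] := laurent_bound g.
have [c hc] := laurent_bound h.
have {}fa := fa _ (leqnn a); have {}gb := gb _ (leqnn b).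
have {}hc := hc _ (leqnn c).
have conv_lt (u v : laurent F) (p q : nat) : (forall i : int, i < - p%:Z -> u i = 0) ->
    (forall i : int, i < - q%:Z -> v i = 0) ->
    forall i : int, i < - (p + q)%:Z -> laurent_mul u v i = 0.
  move=> up vq i ipq; rewrite /= (conv_coefE (c := 0) up vq) ?big_ord0 //.
  lia.
pose m := (`|n| + a + b + c + 1)%N.
rewrite /= (conv_coefE (g := laurent_mul g h) (c := m) fa (conv_lt _ _ _ _ gb hc));
  last by lia.
rewrite (conv_coefE (g := laurent_mul f h) (c := m) gb (conv_lt _ _ _ _ fa hc));
  last by lia.
transitivity (\sum_(k < m) \sum_(l < m) f (k%:Z - a%:Z) * (g (l%:Z - b%:Z) *
    h (n - (k%:Z - a%:Z) - (l%:Z - b%:Z)))).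
  apply: eq_bigr => k _ /=.
  by rewrite (conv_coefE (c := m) gb hc) ?mulr_sumr //; lia.
rewrite exchange_big /=; apply: eq_bigr => l _.
rewrite (conv_coefE (c := m) fa hc) ?mulr_sumr; last by lia.
apply: eq_bigr => k _; rewrite mulrCA; congr (_ * (_ * h _)); lia.
Qed.

Lemma laurent_mulA : associative laurent_mul.
Proof.
by move=> f g h; rewrite [laurent_mul g h]laurent_mulC laurent_mulCA laurent_mulC.
Qed.

Lemma laurent_mul1 : left_id laurent1 laurent_mul.
Proof.
move=> f; apply: laurentP => n /=; rewrite /conv_coef.
rewrite -(fsbig_widen [set 0]) ?fsbig_set1 //= ?mul1r ?subr0 //.
by move=> i [_ /eqP/negPf i0] /=; rewrite i0 mul0r.
Qed.

Lemma laurent_mulDl : left_distributive laurent_mul laurent_add.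
Proof.
move=> f g h; apply: laurentP => n.
have [a fa] := laurent_bound f; have [b gb] := laurent_bound g.
have [c hc] := laurent_bound h.
have {}fa := fa _ (leq_maxl a b); have {}gb := gb _ (leq_maxr a b).
have {}hc := hc _ (leqnn c); set d := maxn a b in fa gb.
have fg i : i < - d%:Z -> laurent_add f g i = 0.
  by move=> id /=; rewrite fa // gb // addr0.
pose m := (`|n| + d + c + 1)%N.
have nm : n + d%:Z + c%:Z < m%:Z by lia.
rewrite /= (conv_coefE (f := laurent_add f g) fg hc nm).
rewrite (conv_coefE fa hc nm) (conv_coefE gb hc nm) -big_split.
by apply: eq_bigr => k _; rewrite mulrDl.
Qed.

Lemma laurent1_neq0 : laurent1 != 0.
Proof.
apply/eqP => /(congr1 (fun f : laurent F => f 0)) /=.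
by apply/eqP; rewrite oner_neq0.
Qed.

HB.instance Definition _ := GRing.Zmodule_isComNzRing.Build (laurent F)
  laurent_mulA laurent_mulC laurent_mul1 laurent_mulDl laurent1_neq0.

Lemma laurent_order f : f != 0 ->
  exists2 N : int, f N != 0 & forall i, i < N -> f i = 0.
Proof.
move=> f0; have [a fa] := laurent_bound f; have {}fa := fa _ (leqnn a).
have exk : exists k : nat, f (k%:Z - a%:Z) != 0.
  apply: contrapT => nex; case/eqP: f0; apply: laurentP => i /=.
  have [/fa //|ai] := ltP i (- a%:Z).
  apply/eqP/negPn/negP => fi; apply: nex; exists (absz (i + a%:Z)).
  suff -> : Posz (absz (i + a%:Z)) - a%:Z = i by [].
  lia.
case: (ex_minnP exk) => k fk mink; exists (k%:Z - a%:Z) => // i ik.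
have [/fa //|ai] := ltP i (- a%:Z).
apply/eqP/negPn/negP => fi.
have := mink (absz (i + a%:Z)).
have -> : Posz (absz (i + a%:Z)) - a%:Z = i by lia.
by move=> /(_ fi); lia.
Qed.

Lemma series_inverse (u : nat -> F) : u 0 != 0 -> exists v : nat -> F,
  forall n : nat, \sum_(k < n.+1) u k * v (n - k)%N = (n == 0)%:R.
Proof.
move=> u0.
pose next (s : seq F) : F := (u 0)^-1 *
  ((size s == 0)%:R - \sum_(k < size s) u k.+1 * s`_(size s - k.+1)).
pose pre := fix pre n := if n is n'.+1 then rcons (pre n') (next (pre n')) else [::].
have szpre n : size (pre n) = n by elim: n => //= n IHn; rewrite size_rcons IHn.
pose v n := next (pre n).
have preE n k : (k < n)%N -> (pre n)`_k = v k.
  elim: n => // n IHn; rewrite ltnS leq_eqVlt /= nth_rcons szpre.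
  by case/predU1P=> [->|kn]; rewrite ?ltnn ?eqxx // kn IHn.
exists v => n; rewrite big_ord_recl subn0 {1}/v /next szpre mulVKf //.
rewrite -[RHS](subrK (\sum_(k < n) u k.+1 * (pre n)`_(n - k.+1))).
congr (_ + _); apply: eq_bigr => k _; rewrite preE //=; have := ltn_ord k; lia.
Qed.

Lemma laurent_inverse f : exists g, (f == 0) || (g * f == 1).
Proof.
have [->|f0] := eqVneq f 0; first by exists 0; rewrite mul0r orTb.
have [N fN f_lt] := laurent_order f0.
pose u (k : nat) := f (k%:Z + N).
have [|v uv] := @series_inverse u; first by rewrite /u add0r.
pose w (i : int) := if 0 <= i + N then v (absz (i + N)) else 0.
have w_lt i : i < - N -> w i = 0 by rewrite /w; case: ifP => //; lia.
have wb : bounded_below w by apply/asboolP; exists (- N).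
exists (Laurent wb); rewrite orFb mulrC; apply/eqP/laurentP => n /=.
have [n0|n0] := ltP n 0.
  rewrite lt_eqF // /conv_coef fsbig1 //= => i _.
  by have [/f_lt ->|Ni] := ltP i N; rewrite ?mul0r // w_lt ?mulr0 //; lia.
rewrite /conv_coef.
pose m := `|n|%N; have nE : n = m%:Z by lia.
pose s := [seq (k%:Z + N : int) | k <- index_iota 0 m.+1].
have us : uniq s by rewrite map_inj_uniq ?iota_uniq // => x y; lia.
rewrite -(fsbig_widen [set` s]) //; last first.
  move=> i [_ /= si].
  have [/f_lt ->|Ni] := ltP i N; first by rewrite mul0r.
  have [ic|ci] := ltP i (m.+1%:Z + N); last by rewrite w_lt ?mulr0 //; lia.
  case: si; apply/mapP; exists (absz ((i : int) - N)); last by lia.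
  by rewrite mem_index_iota; lia.
rewrite -fsbig_seq // /s big_map big_mkord.
rewrite nE eqz_nat -uv; apply: eq_bigr => k _; rewrite /u /w.
have km := ltn_ord k.
have -> : 0 <= m%:Z - (k%:Z + N) + N by lia.
by congr (_ * v _); lia.
Qed.

Definition laurent_inv f :=
  if f == 0 then 0 else xchoose (laurent_inverse f).

Lemma laurent_mulV f : f != 0 -> laurent_inv f * f = 1.
Proof.
move=> f0; rewrite /laurent_inv; case: ifP => [f00|_]; first by rewrite f00 in f0.
by case/orP: (xchooseP (laurent_inverse f)) => [f00|/eqP //]; rewrite f00 in f0.
Qed.

Lemma laurent_inv0 : laurent_inv 0 = 0.
Proof. by rewrite /laurent_inv; case: ifP => // /eqP. Qed.

HB.instance Definition _ :=
  GRing.ComNzRing_isField.Build (laurent F) laurent_mulV laurent_inv0.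

End LaurentField.

Definition perfect_field (F : fieldType) : Prop :=
  forall p : {poly F}, irreducible_poly p -> separable_poly p.

Definition polar (K : fieldType) (V : vectType K) (q : V -> K) (u v : V) : K :=
  q (u + v) - q u - q v.

(* [polar q] is symmetric, so linearity in the second argument is enough for
   it to be bilinear. *)
Record qform (K : fieldType) (V : vectType K) := QForm {
  qf_fun :> V -> K;
  qfZ : forall (a : K) (v : V), qf_fun (a *: v) = a ^+ 2 * qf_fun v;
  qf_polar : forall u : V, scalar (polar qf_fun u) }.

Definition isometric (K : fieldType) (V W : vectType K)
    (q : qform V) (q' : qform W) : Prop :=
  exists f : {linear V -> W}, bijective f /\ forall v, q' (f v) = q v.

Definition anisotropic (K : fieldType) (V : vectType K) (q : qform V) : Prop :=
  forall v : V, v != 0 -> q v != 0.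

Section Constructions.
Variable K : fieldType.

Lemma orth_sumZ (V W : vectType K) (q : qform V) (q' : qform W)
    (a : K) (v : V * W) :
  q (a *: v).1 + q' (a *: v).2 = a ^+ 2 * (q v.1 + q' v.2).
Proof. by rewrite !qfZ mulrDr. Qed.

Lemma orth_sum_polar (V W : vectType K) (q : qform V) (q' : qform W)
    (u : V * W) : scalar (polar (fun v : V * W => q v.1 + q' v.2) u).
Proof.
move=> a v w.
have E x y : polar (fun v : V * W => q v.1 + q' v.2) x y =
    polar q x.1 y.1 + polar q' x.2 y.2 by rewrite /polar /=; ring.
rewrite !E /= !qf_polar; ring.
Qed.

Definition orth_sum (V W : vectType K) (q : qform V) (q' : qform W) :
  qform (V * W)%type := QForm (orth_sumZ q q') (orth_sum_polar q q').

Lemma orth_powZ (V : vectType K) (q : qform V) (n : nat)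
    (a : K) (v : {ffun 'I_n -> V}) :
  \sum_i q ((a *: v) i) = a ^+ 2 * \sum_i q (v i).
Proof. by rewrite mulr_sumr; apply: eq_bigr => i _; rewrite ffunE qfZ. Qed.

Lemma orth_pow_polar (V : vectType K) (q : qform V) (n : nat)
    (u : {ffun 'I_n -> V}) :
  scalar (polar (fun v : {ffun 'I_n -> V} => \sum_i q (v i)) u).
Proof.
move=> a v w.
have E x y : polar (fun v : {ffun 'I_n -> V} => \sum_i q (v i)) x y =
    \sum_i polar q (x i) (y i).
  by rewrite /polar !sumrB; congr (_ - _ - _); apply: eq_bigr => i; rewrite ffunE.
rewrite !E mulr_sumr -big_split; apply: eq_bigr => i _.
by rewrite !ffunE qf_polar.
Qed.

Definition orth_pow (V : vectType K) (q : qform V) (n : nat) :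
  qform {ffun 'I_n -> V} := QForm (orth_powZ q (n := n)) (orth_pow_polar q (n := n)).

Lemma qscaleZ (V : vectType K) (b : K) (q : qform V) (a : K) (v : V) :
  b * q (a *: v) = a ^+ 2 * (b * q v).
Proof. by rewrite qfZ mulrCA. Qed.

Lemma qscale_polar (V : vectType K) (b : K) (q : qform V) (u : V) :
  scalar (polar (fun v => b * q v) u).
Proof.
move=> a v w.
have E x y : polar (fun v => b * q v) x y = b * polar q x y.
  by rewrite /polar; ring.
rewrite !E qf_polar; ring.
Qed.

Definition qscale (V : vectType K) (b : K) (q : qform V) : qform V :=
  QForm (qscaleZ b q) (qscale_polar b q).

Lemma hyp_planeZ (a : K) (v : K^o * K^o) :
  (a *: v).1 * (a *: v).2 = a ^+ 2 * (v.1 * v.2).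
Proof. by rewrite /= /GRing.scale /=; ring. Qed.

Lemma hyp_plane_polar (u : K^o * K^o) :
  scalar (polar (fun v : K^o * K^o => v.1 * v.2) u).
Proof. by move=> a v w; rewrite /polar /= /GRing.scale /=; ring. Qed.

Definition hyp_plane : qform (K^o * K^o)%type := QForm hyp_planeZ hyp_plane_polar.

Lemma binary_qfZ (c a : K) (v : K^o * K^o) :
  (a *: v).1 ^+ 2 + (a *: v).1 * (a *: v).2 + c * (a *: v).2 ^+ 2 =
  a ^+ 2 * (v.1 ^+ 2 + v.1 * v.2 + c * v.2 ^+ 2).
Proof. by rewrite /= /GRing.scale /=; ring. Qed.

Lemma binary_qf_polar (c : K) (u : K^o * K^o) :
  scalar (polar (fun v : K^o * K^o => v.1 ^+ 2 + v.1 * v.2 + c * v.2 ^+ 2) u).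
Proof. by move=> a v w; rewrite /polar /= /GRing.scale /=; ring. Qed.

(* The form [1, a] : (x, y) |-> x^2 + x y + a y^2. *)
Definition binary_qf (a : K) : qform (K^o * K^o)%type :=
  QForm (binary_qfZ a) (binary_qf_polar a).

(* The form <<b, a]] = [1, a] _|_ b [1, a]. *)
Definition pfister2 (b a : K) :=
  orth_sum (binary_qf a) (qscale b (binary_qf a)).

Lemma qform_of_mxZ (n : nat) (A : 'M[K]_n) (a : K) (v : 'rV[K]_n) :
  ((a *: v) *m A *m (a *: v)^T) 0 0 = a ^+ 2 * (v *m A *m v^T) 0 0.
Proof. by rewrite linearZ /= -!scalemxAl -scalemxAr scalerA mxE. Qed.

Lemma qform_of_mx_polar (n : nat) (A : 'M[K]_n) (u : 'rV[K]_n) :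
  scalar (polar (fun v : 'rV[K]_n => (v *m A *m v^T) 0 0) u).
Proof.
move=> a v w.
have E x y : polar (fun v : 'rV[K]_n => (v *m A *m v^T) 0 0) x y =
    (x *m A *m y^T + y *m A *m x^T) 0 0.
  by rewrite /polar linearD !mulmxDl !mulmxDr !mxE; ring.
rewrite !E linearP !(mulmxDl, mulmxDr) -!scalemxAl -!scalemxAr !mxE; ring.
Qed.

Definition qform_of_mx (n : nat) (A : 'M[K]_n) : qform 'rV[K]_n :=
  QForm (qform_of_mxZ A) (qform_of_mx_polar A).

End Constructions.

(* With respect to a basis (e_i) of V,
   q (\sum_i x_i e_i) = \sum_i q(e_i) x_i^2 + \sum_(i < j) b_q(e_i, e_j) x_i x_j,
   where b_q is the polar form; [qform_mx] is the upper triangular matrix of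
   these coefficients. *)
Definition qform_mx (K : fieldType) (V : vectType K) (q : qform V) :
    'M[K]_(\dim {:V}) :=
  let e := vbasis {:V} in
  \matrix_(i, j) if i == j then q e`_i
                 else if (i < j)%N then polar q e`_i e`_j else 0.

Lemma qform_sum (K : fieldType) (V : vectType K) (q : qform V)
    (n : nat) (e : nat -> V) (x : nat -> K) :
  q (\sum_(i < n) x i *: e i) =
  \sum_(i < n) \sum_(j < n) x i * (if i == j :> nat then q (e i)
    else if (i < j)%N then polar q (e i) (e j) else 0) * x j.
Proof.
have polC u v : polar q u v = polar q v u by rewrite /polar (addrC u v) addrAC.
have q0 : q 0 = 0 by rewrite -[X in q X](scale0r 0) qfZ expr2 !mul0r.
have pol0 u : polar q u 0 = 0 by rewrite /polar addr0 q0 subr0 subrr.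
have polS u m : polar q (\sum_(i < m) x i *: e i) u =
    \sum_(i < m) x i * polar q (e i) u.
  rewrite polC; elim: m => [|m IHm]; first by rewrite !big_ord0.
  by rewrite !big_ord_recr /= addrC qf_polar IHm addrC (polC u).
elim: n => [|n IHn]; first by rewrite !big_ord0.
have qD u v : q (u + v) = q u + q v + polar q u v by rewrite /polar; ring.
rewrite !big_ord_recr /= qD IHn qfZ -[in polar _ _ _](addr0 (x n *: e n)) qf_polar.
rewrite pol0 addr0 polS eqxx.
rewrite [X in _ = _ + (X + _)]big1 ?add0r => [|i _]; last first.
  by have := ltn_ord i; case: ltngtP => // _ _; rewrite mulr0 mul0r.
rewrite -addrA [X in _ + X]addrC addrA mulr_sumr -big_split /=.
congr (_ + _); last by ring.
apply: eq_bigr => i _; rewrite big_ord_recr /=; congr (_ + _).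
by have := ltn_ord i; case: ltngtP => // _ _; ring.
Qed.

Lemma qform_mxE (K : fieldType) (V : vectType K) (q : qform V)
    (x : 'rV[K]_(\dim {:V})) :
  qform_of_mx (qform_mx q) x = q (\sum_i x 0 i *: (vbasis {:V})`_i).
Proof.
pose y (i : nat) : K := odflt 0 (omap (x 0) (insub i)).
have yE (i : 'I__) : y i = x 0 i by rewrite /y valK.
transitivity (q (\sum_(i < \dim {:V}) y i *: (vbasis {:V})`_i)); last first.
  by congr (q _); apply: eq_bigr => i _; rewrite yE.
rewrite (qform_sum q _ (fun i => (vbasis {:V})`_i)) /= mxE exchange_big /=.
apply: eq_bigr => j _; rewrite !mxE mulr_suml; apply: eq_bigr => i _.
by rewrite !mxE !yE.
Qed.

(* The scalar extension of q to L: V (x)_K L is identified with the space of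
   coordinate vectors over L in the basis [vbasis {:V}]. *)
Definition qf_ext (K : fieldType) (V : vectType K) (q : qform V)
    (L : fieldExtType K) : qform 'rV[L]_(\dim {:V}) :=
  qform_of_mx (map_mx (in_alg L) (qform_mx q)).

Definition hyperbolic (K : fieldType) (V : vectType K) (q : qform V) : Prop :=
  exists n : nat, isometric q (orth_pow (hyp_plane K) n).

Definition is_pfister2 (K : fieldType) (V : vectType K) (q : qform V) : Prop :=
  exists a b : K, b != 0 /\ isometric q (pfister2 b a).

Definition totally_separably_linked (K : fieldType) (V W : vectType K)
    (q : qform V) (q' : qform W) : Prop :=
  forall L : fieldExtType K, \dim {:L} = 2%N -> separable 1%VS {:L} ->
    hyperbolic (qf_ext q L) <-> hyperbolic (qf_ext q' L).

(* Main.v *)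
From HB Require Import structures.
Require Import Defs.
From mathcomp Require Import all_boot all_order all_algebra all_field.
From mathcomp Require Import boolp classical_sets functions fsbigop.
From mathcomp Require Import ring zify.
Import Order.TTheory GRing.Theory.
Local Open Scope ring_scope.

(* Since F is perfect, K = K^2 + t K^2, so the slope b of an anisotropic
   <<b, a]], being no square, can be exchanged for t.  In <<t, c]] the entry c
   only matters modulo the elements x^2 + x + t s^2; these include t K^2, which
   allows halving the pole of c, and, by solving x^2 + x = d coefficientwise,
   every series d without constant term or pole.  Hence every anisotropic 2-fold
   Pfister form is some <<t, c]] with c in F.  Given a second form <<t, c']],
   the first becomes hyperbolic over L = K(th) with th^2 + th = c, hence so does
   the second; an isotropic vector u + th v over L means Q' v = b(u, v) and
   Q' u = c Q' v over K.  Comparing lowest coefficients yields the same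
   equations over F for the norm form [1, c'], and so an element of
   F(th') of trace 1 and norm c, that is p with p^2 + p + c' = c. *)

Set Implicit Arguments.
Unset Strict Implicit.
Unset Printing Implicit Defensive.

(** * Isometries of 2-fold Pfister forms *)

Section Isometry.
Variable K : fieldType.
Implicit Types U V W : vectType K.

Lemma isometric_can V W (q : qform V) (q' : qform W) (f : V -> W) (g : W -> V) :
  linear f -> cancel f g -> cancel g f -> (forall v, q' (f v) = q v) ->
  isometric q q'.
Proof.
move=> lf fK gK qf.
pose hf := GRing.isLinear.Build K V W _ f lf.
pose f' : {linear V -> W} := HB.pack f hf.
by exists f'; split=> //; exists g.
Qed.

Lemma isometric_sym V W (q : qform V) (q' : qform W) :
  isometric q q' -> isometric q' q.
Proof.
move=> [f [[g fK gK] qf]]; apply: (isometric_can (can2_linear fK gK) gK fK).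
by move=> v; rewrite -qf gK.
Qed.

Lemma isometric_trans U V W (q : qform U) (q' : qform V) (q'' : qform W) :
  isometric q q' -> isometric q' q'' -> isometric q q''.
Proof.
move=> [f [bf qf]] [g [bg qg]]; exists (g \o f : {linear U -> W}).
by split=> [|v]; [exact: bij_comp | rewrite /= qg qf].
Qed.

Lemma isometric_anisotropic V W (q : qform V) (q' : qform W) :
  isometric q q' -> anisotropic q -> anisotropic q'.
Proof.
move=> /isometric_sym[f [bf qf]] aq v v0; rewrite -qf; apply: aq.
by rewrite -(raddf0 f) (inj_eq (bij_inj bf)).
Qed.

Lemma isometric_polar V W (q : qform V) (q' : qform W) (f : {linear V -> W}) :
  (forall v, q' (f v) = q v) -> forall u v, polar q' (f u) (f v) = polar q u v.
Proof. by move=> qf u v; rewrite /polar -linearD !qf. Qed.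

End Isometry.

(** * Moves on the slope and the entry in characteristic 2 *)

Section Pfister.
Variable K : fieldType.
Hypothesis charK2 : 2%N \in [pchar K].
Let two0 : 2%:R = 0 :> K. Proof. exact: pcharf0. Qed.

(** The form <<b, c]] is the norm form of the quaternion algebra with [i^2 + i = c], [j^2 = b] and
    [i j + j i = j]. There [u + v j] has square [n], and letting it replace [j] multiplies the entry
    by [n / (b v^2)]. *)
Lemma pfister2_change_slope (b n u v a : K) :
  b != 0 -> n != 0 -> v != 0 -> n = u ^+ 2 + b * v ^+ 2 ->
  isometric (pfister2 b (a * b * v ^+ 2 / n)) (pfister2 n a).
Proof.
move=> b0 n0 v0 nE.
pose f (x : (K^o * K^o) * (K^o * K^o)) : (K^o * K^o) * (K^o * K^o) :=
  ((x.1.1 + x.2.1 * u / v, x.1.2), (x.2.1 / v, x.1.2 * u / n + x.2.2 * b * v / n)).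
pose g (x : (K^o * K^o) * (K^o * K^o)) : (K^o * K^o) * (K^o * K^o) :=
  ((x.1.1 - x.2.1 * u, x.1.2), (x.2.1 * v, (x.2.2 * n - x.1.2 * u) / (b * v))).
apply: (isometric_can (f := f) (g := g)).
- by move=> k x y; congr (_, _, (_, _)); rewrite /= /GRing.scale /=; ring.
- by case=> [[x y] [z w]]; rewrite /f /g /=; congr (_, _, (_, _)); field;
    rewrite ?v0 ?n0 ?b0.
- by case=> [[x y] [z w]]; rewrite /f /g /=; congr (_, _, (_, _)); field;
    rewrite ?v0 ?n0 ?b0.
- case=> [[x y] [z w]]; rewrite /f /=.
  (* The two sides differ by [2 * e], the doubled cross terms. *)
  pose e := x * z * u / v + z ^+ 2 * u ^+ 2 / v ^+ 2 + z * u * y / v +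
    a * y ^+ 2 * u ^+ 2 / n + a * y * u * b * v * w / n.
  rewrite -[RHS]addr0 -(mul0r e) -two0 /e.
  have -> : b = (n - u ^+ 2) / v ^+ 2 by rewrite nE; field.
  by field; rewrite v0 n0.
Qed.

(** In the same quaternion algebra, [i + x + s j] can replace [i]: the relation with [j] is kept,
    and the entry grows by [x^2 + x + b s^2]. *)
Lemma pfister2_add_artin_schreier (b c x s : K) :
  isometric (pfister2 b (c + (x ^+ 2 + x + b * s ^+ 2))) (pfister2 b c).
Proof.
pose f (v : (K^o * K^o) * (K^o * K^o)) : (K^o * K^o) * (K^o * K^o) :=
  ((v.1.1 + v.1.2 * x + v.2.2 * (b * s), v.1.2), (v.2.1 + v.1.2 * s + v.2.2 * x, v.2.2)).
pose g (v : (K^o * K^o) * (K^o * K^o)) : (K^o * K^o) * (K^o * K^o) :=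
  ((v.1.1 - v.1.2 * x - v.2.2 * (b * s), v.1.2), (v.2.1 - v.1.2 * s - v.2.2 * x, v.2.2)).
apply: (isometric_can (f := f) (g := g)).
- by move=> k u v; congr (_, _, (_, _)); rewrite /= /GRing.scale /=; ring.
- by case=> [[? ?] [? ?]]; rewrite /f /g /=; congr (_, _, (_, _)); ring.
- by case=> [[? ?] [? ?]]; rewrite /f /g /=; congr (_, _, (_, _)); ring.
- case=> [[X Y] [Z W]]; rewrite /f /=.
  (* Again [e] is half of the surplus cross terms, which vanish in characteristic 2. *)
  pose e := X * Y * x + X * W * b * s + Y * W * x * b * s +
    b * (Z * Y * s + Z * W * x + Y * W * s * x) + Y * W * b * s.
  by rewrite -[RHS]addr0 -(mul0r e) -two0 /e; ring.
Qed.

(** Since [2 x = 0], the two entries differ by [x^2 + x + b s^2]. Trading a square for its root is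
    what halves poles later. *)
Lemma pfister2_unsquare_slot (b x s : K) :
  isometric (pfister2 b (x ^+ 2 + b * s ^+ 2)) (pfister2 b x).
Proof.
have -> : x ^+ 2 + b * s ^+ 2 = x + (x ^+ 2 + x + b * s ^+ 2).
  by rewrite -[LHS]add0r -(addrr_pchar2 charK2 x); ring.
exact: pfister2_add_artin_schreier.
Qed.

Lemma pfister2_sqr_not_anisotropic (u a : K) : ~ anisotropic (pfister2 (u ^+ 2) a).
Proof.
move=> /(_ ((u, 0), (1, 0))) aq.
suff /negP[] : pfister2 (u ^+ 2) a ((u, 0), (1, 0)) != 0.
  apply/eqP; transitivity (u ^+ 2 + u ^+ 2); first by rewrite /=; ring.
  exact: addrr_pchar2.
by apply: aq; apply/eqP => -[_ /eqP]; rewrite oner_eq0.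
Qed.

(** A root [x] would make [(x, 1)] a zero of [1, a]. Hence [X^2 + X - a] is irreducible. *)
Lemma pfister2_anisotropic_noroot (b a : K) :
  anisotropic (pfister2 b a) -> forall x, x ^+ 2 + x != a.
Proof.
move=> aq x; have : ((x, 1), (0, 0)) != 0 :> (K^o * K^o) * (K^o * K^o).
  by apply/eqP => -[_ /eqP]; rewrite oner_eq0.
move/aq; apply: contra_neq => <-.
by rewrite -[RHS](addrr_pchar2 charK2 (x ^+ 2 + x)) /=; ring.
Qed.

End Pfister.

(** * Laurent series over a perfect field of characteristic 2 *)

Section LaurentCoefficients.
Variable F : fieldType.
Implicit Types (f g : laurent F) (a b : F) (i j k n : int).

Definition vanishes_below f n : Prop := forall i, i < n -> f i = 0.

Lemma vanishes_below_leq f m n : n <= m -> vanishes_below f m -> vanishes_below f n.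
Proof. by move=> nm fm i /lt_le_trans/(_ nm)/fm. Qed.

Lemma vanishes_belowM f g m n : vanishes_below f m -> vanishes_below g n ->
  vanishes_below (f * g) (m + n).
Proof.
move=> fm gn i imn; apply: fsbig1 => j _ /=.
by have [/fm->|mj] := ltP j m; rewrite ?mul0r // gn ?mulr0 //; lia.
Qed.

Lemma coefM_low f g m n : vanishes_below f m -> vanishes_below g n ->
  (f * g) (m + n) = f m * g n.
Proof.
move=> fm gn; rewrite [LHS]/= /conv_coef -(fsbig_widen [set m]) ?fsbig_set1 //=.
  by rewrite addrC addKr.
move=> i [_ /eqP/= im]; have [/fm->|mi] := ltP i m; first by rewrite mul0r.
by rewrite gn ?mulr0 //; move: im; lia.
Qed.

Lemma bounded_below_monomial a n :
  bounded_below (fun i => if i == n then a else 0).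
Proof. by apply/asboolP; exists n => i /lt_eqF->. Qed.

(** [monomial 1 1] is the uniformizer t, and [monomial a 0] embeds the constants. *)
Definition monomial a n : laurent F := Laurent (bounded_below_monomial a n).

Lemma coef_monomialM a n f i : (monomial a n * f) i = a * f (i - n).
Proof.
rewrite [LHS]/= /conv_coef -(fsbig_widen [set n]) ?fsbig_set1 //= ?eqxx //.
by move=> j [_ /eqP/negPf jn] /=; rewrite jn mul0r.
Qed.

Lemma monomial0X2 a : monomial (a ^+ 2) 0 = monomial a 0 ^+ 2.
Proof.
apply: laurentP => i; rewrite expr2 coef_monomialM subr0 /=.
by case: ifP; rewrite ?mulr0.
Qed.

Lemma monomial_neq0 a n : a != 0 -> monomial a n != 0.
Proof.
move=> a0; apply/eqP => /(congr1 (fun f : laurent F => f n)) /= /eqP.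
by rewrite eqxx (negPf a0).
Qed.

End LaurentCoefficients.

(** * Squares and Artin-Schreier equations in characteristic 2 *)

Section Char2.
Variable F : fieldType.
Hypothesis charF2 : 2%N \in [pchar F].
Implicit Types (f g : laurent F) (i n : int).

Lemma laurent_pchar2 : 2%N \in [pchar (laurent F)].
Proof.
apply/andP; split=> //; apply/eqP; apply: laurentP => i.
change ((1 : laurent F) i + (1 : laurent F) i = 0).
exact: addrr_pchar2.
Qed.

(** The terms at [k] and [n - k] are equal and cancel; only a middle term, present for even [n],
    survives. The induction strips the two outer terms. *)
Lemma sum_antidiagonal_pchar2 (n : nat) (g : nat -> F) :
  \sum_(k < n.+1) g k * g (n - k)%N = if odd n then 0 else g n./2 ^+ 2.
Proof.
elim/ltn_ind: n g => -[_|[_|n IHn]] g.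
- by rewrite big_ord_recl big_ord0 addr0 /= expr2.
- by rewrite !big_ord_recl big_ord0 /= addr0 /bump /= mulrC addrr_pchar2.
rewrite big_ord_recl big_ord_recr /= /bump /= add1n subnn subn0 [g _ * g 0%N]mulrC.
rewrite addrCA addrr_pchar2 // addr0.
rewrite (eq_bigr (fun k : 'I_n.+1 => g k.+1 * g (n - k).+1)); last first.
  by move=> k _; congr (g _ * g _); have := ltn_ord k; lia.
by rewrite (IHn n _ (fun k => g k.+1)) // negbK.
Qed.

(** The Frobenius map squares the coefficients and doubles the exponents. *)
Lemma coef_sqr f i :
  (f ^+ 2) (i + i) = f i ^+ 2 /\ (f ^+ 2) (i + i + 1) = 0.
Proof.
have [a /(_ a (leqnn a)) fa] := laurent_bound f.
have low n : n + a%:Z + a%:Z < 0 -> (f ^+ 2) n = 0.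
  by move=> na; rewrite expr2 [LHS]/= (conv_coefE (c := 0) fa fa na) big_ord0.
have high (m : nat) : (f ^+ 2) (m%:Z - a%:Z - a%:Z) =
    if odd m then 0 else f ((m./2)%:Z - a%:Z) ^+ 2.
  rewrite expr2 [LHS]/= (conv_coefE (c := m.+1) fa fa); last by lia.
  rewrite -(sum_antidiagonal_pchar2 m (fun k => f (k%:Z - a%:Z))).
  by apply: eq_bigr => k _; congr (_ * f _); have := ltn_ord k; lia.
have [ia|ai] := ltP i (- a%:Z); first by rewrite fa // expr0n !low //; lia.
pose k := `|(i + a%:Z)%R|%N; have -> : i = k%:Z - a%:Z by lia.
split.
  have -> : k%:Z - a%:Z + (k%:Z - a%:Z) = (k.*2)%:Z - a%:Z - a%:Z by lia.
  by rewrite high odd_double doubleK.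
have -> : k%:Z - a%:Z + (k%:Z - a%:Z) + 1 = (k.*2.+1)%:Z - a%:Z - a%:Z by lia.
by rewrite high /= odd_double.
Qed.

Lemma coef_sqr_even f i : (f ^+ 2) (i + i) = f i ^+ 2.
Proof. by case: (coef_sqr f i). Qed.

Lemma coef_sqr_odd f i : (f ^+ 2) (i + i + 1) = 0.
Proof. by case: (coef_sqr f i). Qed.

Lemma int_parity n : exists i, n = i + i \/ n = i + i + 1.
Proof. by exists (n %/ 2)%Z; lia. Qed.

(** These are the equations of [x^2 + x = d] coefficient by coefficient. They are recursive because
    [k < 2k] for positive [k]; index 0 is set apart, its equation being quadratic in the unknown. *)
Lemma artin_schreier_series (d : nat -> F) : exists x : nat -> F,
  [/\ x 0%N = 0, forall k, x k.*2.+1 = d k.*2.+1 &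
      forall k, (0 < k)%N -> x k.*2 = d k.*2 + x k ^+ 2].
Proof.
(* [h m n] is the value at [n], computed with fuel [m]. *)
pose h := fix h (m n : nat) : F := if m is m'.+1 then
  if n is 0 then 0 else d n + (if odd n then 0 else h m' n./2 ^+ 2) else 0.
(* The value no longer depends on the fuel once the fuel reaches the index. *)
have hE m : forall m' (n : nat), (n <= m)%N -> (n <= m')%N -> h m n = h m' n.
  elim: m => [|m IHm] [|m'] [|n] //= nm nm'; congr (_ + _).
  by case: odd => //; congr (_ ^+ 2); apply: IHm; lia.
have hn (n : nat) : (0 < n)%N ->
    h n n = d n + (if odd n then 0 else h n./2 n./2 ^+ 2).
  case: n => // n _; congr (_ + _); case: odd => //.
  by congr (_ ^+ 2); apply: hE; lia.
exists (fun n : nat => h n n); split=> [//|k|k k0]; rewrite hn ?double_gt0 //.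
  by rewrite /= odd_double addr0.
by rewrite odd_double doubleK.
Qed.

(** The constant term of [f] vanishes too, so the recursion can start from the value 0. *)
Lemma artin_schreier_laurent f : vanishes_below f 1 ->
  exists x : laurent F, f = x ^+ 2 + x.
Proof.
move=> f1; have [x [x0 xodd xeven]] := artin_schreier_series (fun k => f k%:Z).
pose y i := if 0 <= i then x `|i|%N else 0.
have yb : bounded_below y.
  by apply/asboolP; exists 0 => i; rewrite /y; case: ifP => //; lia.
have y_neg i : i < 0 -> y i = 0 by rewrite /y; case: ifP => //; lia.
exists (Laurent yb); apply: laurentP => n.
rewrite [RHS](_ : _ = (Laurent yb ^+ 2) n + y n) //.
have [i [->|->]] := int_parity n; last first.
  rewrite coef_sqr_odd add0r.
  have [i0|i0] := ltP i 0; first by rewrite f1 ?y_neg //; lia.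
  rewrite /y ifT; last by lia.
  have -> : `|(i + i + 1)%R|%N = `|i|%N.*2.+1 by lia.
  by rewrite xodd; congr (f _); lia.
rewrite coef_sqr_even /=.
have [i0|i0] := ltP i 1.
  rewrite f1; last by lia.
  have [->|i0'] := eqVneq i 0; last by rewrite !y_neg ?expr0n ?addr0 //; lia.
  by rewrite /y /= x0 expr0n addr0.
rewrite /y !ifT; try lia.
have -> : `|(i + i)%R|%N = `|i|%N.*2 by lia.
rewrite xeven; last by lia.
by rewrite addrCA (addrr_pchar2 charF2) addr0; congr (f _); lia.
Qed.

(** * Perfect coefficients: reduction to slope t and constant entry *)

Hypothesis perfF : perfect_field F.

(** If [a] had no square root, [X^2 - a] would be irreducible with derivative [2 X = 0], hence
    inseparable. *)
Lemma perfect_pchar2_sqrt (a : F) : exists b, b ^+ 2 == a.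
Proof.
apply: contrapT => nb; pose p : {poly F} := 'X^2 - a%:P.
have sp : size p = 3 by rewrite size_XnsubC.
have /perfF : irreducible_poly p.
  apply: cubic_irreducible; rewrite ?sp // => x; apply/negP => /rootP.
  by rewrite /p !hornerE => /eqP; rewrite subr_eq0 => xa; apply: nb; exists x.
rewrite unlock /p derivB derivXn derivC subr0 -mulr_natr.
have -> : 2%:R = 0 :> {poly F} by rewrite -polyC_natr (pcharf0 charF2).
by rewrite mulr0 coprimep0 -/p -size_poly_eq1 sp.
Qed.

(** Square roots of the even coefficients form [u], those of the odd ones form [v]. As [u] only sees
    even indices, the bound [n + n - 1] is enough for it. *)
Lemma laurent_sqr_decomposition f : exists u v : laurent F,
  f = u ^+ 2 + monomial 1 1 * v ^+ 2 /\
  forall n, vanishes_below f (n + n - 1) -> vanishes_below u n.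
Proof.
pose s (a : F) := xchoose (perfect_pchar2_sqrt a).
have sK a : s a ^+ 2 = a by apply/eqP/(xchooseP (perfect_pchar2_sqrt a)).
have s0 : s 0 = 0 by apply/eqP; rewrite -sqrf_eq0 sK.
have [N fN] := laurent_ltP f.
have ub : bounded_below (fun i => s (f (i + i))).
  by apply/asboolP; exists (- `|N|) => i iN; rewrite fN ?s0 //; lia.
have vb : bounded_below (fun i => s (f (i + i + 1))).
  by apply/asboolP; exists (- `|N| - 1) => i iN; rewrite fN ?s0 //; lia.
exists (Laurent ub), (Laurent vb); split; last first.
  by move=> n fn i ni /=; rewrite fn ?s0 //; lia.
apply: laurentP => n; set u := Laurent ub; set v := Laurent vb.
rewrite [RHS](_ : _ = (u ^+ 2) n + (monomial 1 1 * v ^+ 2) n) //.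
rewrite coef_monomialM mul1r.
have [i [->|->]] := int_parity n.
  have -> : i + i - 1 = (i - 1) + (i - 1) + 1 by lia.
  by rewrite coef_sqr_odd addr0 coef_sqr_even sK.
by rewrite coef_sqr_odd addrK coef_sqr_even add0r sK.
Qed.

(** Induction on a bound for the pole: writing [c = u^2 + t v^2], the entry [c] can be replaced by
    [u], whose pole is about half as long. *)
Lemma pfister2_reduce_integral (c : laurent F) : exists2 c' : laurent F,
  vanishes_below c' 0 &
  isometric (pfister2 (monomial 1 1) c) (pfister2 (monomial 1 1) c').
Proof.
have [a /(_ a (leqnn a))] := laurent_bound c; elim: a c => [|a IHa] c ca.
  by exists c => //; apply: (isometric_can (f := id) (g := id)).
have [u [v [cE uc]]] := laurent_sqr_decomposition c.
have [|c' c'0 uc'] := IHa u.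
  (* With [n = - a] this amounts to [- 2 a - 1 <= - (a + 1)]. *)
  apply: uc; apply: vanishes_below_leq ca; lia.
exists c' => //; apply: isometric_trans uc'.
by rewrite cE; exact: pfister2_unsquare_slot laurent_pchar2 _ _ _.
Qed.

(** An integral entry minus its constant term has the form [x^2 + x], which is absorbed with
    [s = 0]. *)
Lemma pfister2_reduce_constant (c : laurent F) : exists a : F,
  isometric (pfister2 (monomial 1 1) c) (pfister2 (monomial 1 1) (monomial a 0)).
Proof.
have [c' c'0 cc'] := pfister2_reduce_integral c; exists (c' 0).
apply: isometric_trans cc' _.
have [|x xE] := @artin_schreier_laurent (c' - monomial (c' 0) 0).
  move=> i i1; rewrite [LHS](_ : _ = c' i - monomial (c' 0) 0 i) //=.
  by case: eqP => [->|i0]; rewrite ?subrr // c'0 ?subr0 //; lia.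
have := pfister2_add_artin_schreier laurent_pchar2
  (monomial 1 1) (monomial (c' 0) 0) x 0.
by rewrite expr0n mulr0 addr0 -xE addrC subrK.
Qed.

(** In [b = u^2 + t v^2] anisotropy forces [v] to be nonzero, so the slope [b] can be exchanged for
    t before the entry is reduced. *)
Lemma pfister2_constant_form (V : vectType (laurent F)) (q : qform V) :
  is_pfister2 q -> anisotropic q ->
  exists a : F, isometric q (pfister2 (monomial 1 1) (monomial a 0)).
Proof.
move=> [c [b [b0 qE]]] aq.
have [u [v [bE _]]] := laurent_sqr_decomposition b.
have v0 : v != 0.
  apply/eqP => v0; rewrite v0 expr0n mulr0 addr0 in bE.
  apply: (@pfister2_sqr_not_anisotropic _ laurent_pchar2 u c).
  by rewrite -bE; exact: isometric_anisotropic qE aq.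
have t0 : monomial (1 : F) 1 != 0 by rewrite monomial_neq0 ?oner_neq0.
have [a aE] := pfister2_reduce_constant (c * monomial 1 1 * v ^+ 2 / b).
exists a; apply: isometric_trans qE _; apply: isometric_trans aE.
exact/isometric_sym/(pfister2_change_slope laurent_pchar2 _ t0 b0 v0 bE).
Qed.

End Char2.

(** * Quadratic separable extensions *)

(** Adjoin a root of [X^2 + X - c]: irreducible because it is quadratic without roots, separable
    because its derivative is 1. The last two clauses say that 1 and [th] form a basis. *)
Lemma artin_schreier_extension (K : fieldType) (c : K) :
  2%N \in [pchar K] -> (forall x, x ^+ 2 + x != c) ->
  exists (L : fieldExtType K) (th : L),
    [/\ \dim {:L} = 2%N, separable 1 {:L}, th ^+ 2 + th = c%:A,
        forall w : L, exists u v : K, w = u%:A + th * v%:A &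
        forall u v : K, u%:A + th * v%:A = 0 -> u = 0 /\ v = 0].
Proof.
move=> charK2 noroot; pose p : {poly K} := 'X^2 + ('X - c%:P).
have sp : size p = 3 by rewrite size_polyDl size_polyXn // size_XsubC.
have irr_p : irreducible_poly p.
  apply: cubic_irreducible; rewrite ?sp // => x.
  by have := noroot x; rewrite rootE /p !hornerE -subr_eq0.
have [L dimL [th throot thgen]] := irredp_FAdjoin irr_p.
rewrite sp /= in dimL; exists L, th.
have thE : th ^+ 2 + th = c%:A.
  move: throot; rewrite rootE /p rmorphD rmorphB /= map_polyXn map_polyX map_polyC /=.
  by rewrite !hornerE => th0; apply/eqP; rewrite -subr_eq0.
split=> //.
- rewrite -thgen -adjoin_seq1; apply: separable_Fadjoin_seq => /=; rewrite andbT.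
  apply/separable_elementP; exists (map_poly (in_alg L) p); split=> //.
    exact: alg_polyOver.
  rewrite separable_map unlock /p derivD derivB derivXn derivX derivC subr0.
  rewrite -mulr_natr -polyC_natr (pcharf0 charK2) mulr0 add0r.
  exact: coprimep1.
- move=> w; have /Fadjoin_poly_eq <- : w \in <<1; th>>%VS by rewrite thgen memvf.
  set r := Fadjoin_poly _ _ _.
  have sr : (size r <= 2)%N.
    apply: leq_trans (size_Fadjoin_poly _ _ _) _.
    by rewrite adjoin_degreeE thgen dimL dimv1.
  have /polyOverP r1 : r \is a polyOver 1%VS := Fadjoin_polyOver _ _ _.
  have /vlineP[u uE] := r1 0%N; have /vlineP[v vE] := r1 1%N.
  exists u, v; rewrite (horner_coef_wide _ sr) !big_ord_recl big_ord0 /= /bump /=.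
  by rewrite uE vE expr0 mulr1 addr0 expr1 [_ * th]mulrC.
- move=> u v uv0; have [v0|v0] := eqVneq v 0.
    split=> //; move: uv0; rewrite v0 scale0r mulr0 addr0 => /eqP.
    by rewrite scaler_eq0 oner_eq0 orbF => /eqP.
  (* A relation with nonzero [v] would put [th] in K, against [noroot]. *)
  have thK : th = (- (u / v))%:A.
    have vA0 : v%:A != 0 :> L by rewrite scaler_eq0 oner_eq0 orbF.
    apply: (mulIf vA0); rewrite -!(in_algE L) -rmorphM mulNr divfK // rmorphN /=.
    by apply/eqP; rewrite -addr_eq0 addrC; apply/eqP.
  case/eqP: (noroot (- (u / v))); apply: (fmorph_inj (in_alg L)).
  by rewrite rmorphD rmorphXn /= -thK.
Qed.

(** Here [1, th^2 + th] factors as [(x + th y) (x + th y + y)], and the two factors are coordinates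
    on a hyperbolic plane; [b] is put into the first factor of the second plane. *)
Lemma pfister2_hyperbolic (K : fieldType) (b th : K) :
  2%N \in [pchar K] -> b != 0 -> hyperbolic (pfister2 b (th ^+ 2 + th)).
Proof.
move=> charK2 b0; exists 2.
pose f (v : (K^o * K^o) * (K^o * K^o)) : {ffun 'I_2 -> K^o * K^o} :=
  [ffun i : 'I_2 => if i == 0 then (v.1.1 + th * v.1.2, v.1.1 + th * v.1.2 + v.1.2)
    else (b * (v.2.1 + th * v.2.2), v.2.1 + th * v.2.2 + v.2.2)].
pose g (h : {ffun 'I_2 -> K^o * K^o}) : (K^o * K^o) * (K^o * K^o) :=
  let p := h 0 in let r := h 1 in
  ((p.1 - th * (p.2 - p.1), p.2 - p.1),
   (r.1 / b - th * (r.2 - r.1 / b), r.2 - r.1 / b)).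
apply: (isometric_can (f := f) (g := g)).
- move=> k u v; apply/ffunP=> i; rewrite !ffunE.
  by case: ifP => _; congr (_, _); rewrite /= /GRing.scale /=; ring.
- by case=> [[x y] [z w]]; rewrite /g !ffunE /=; congr (_, _, (_, _)); field.
- move=> h; apply/ffunP=> i; rewrite ffunE /g /=.
  have [->|i0] := eqVneq i 0.
    by case: (h 0) => x y; congr (_, _) => /=; ring.
  have -> : i = 1 by apply: val_inj; case: i i0 => [[|[|]]].
  by case: (h 1) => x y; congr (_, _) => /=; field.
- case=> [[x y] [z w]]; rewrite /= !big_ord_recl big_ord0 !ffunE /= addr0.
  rewrite -[RHS]addr0 -(mul0r (th * x * y + b * th * z * w)) -(pcharf0 charK2).
  by ring.
Qed.

(** * Scalar extension in coordinates *)

Section ScalarExtension.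
Variables (K : fieldType) (V : vectType K) (q : qform V) (L : fieldExtType K).
Local Notation e i := ((vbasis {:V})`_i).

Lemma qf_ext_map (a : 'rV[K]_(\dim {:V})) :
  qf_ext q L (map_mx (in_alg L) a) = (q (\sum_i a 0 i *: e i))%:A.
Proof. by rewrite -qform_mxE /= map_trmx -!map_mxM mxE. Qed.

Lemma polar_qf_ext_map (a b : 'rV[K]_(\dim {:V})) :
  polar (qf_ext q L) (map_mx (in_alg L) a) (map_mx (in_alg L) b) =
  (polar q (\sum_i a 0 i *: e i) (\sum_i b 0 i *: e i))%:A.
Proof.
rewrite /polar -map_mxD !qf_ext_map -!(in_algE L) -!rmorphB; congr (_ (q _ - _ - _)).
by rewrite -big_split; apply: eq_bigr => i _; rewrite mxE scalerDl.
Qed.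

(** The L-linear extension of [j] respects the forms, since both have the same coefficient matrix:
    [j] preserves the values on the basis and, being additive, the polar values. *)
Lemma qf_ext_sum (W : vectType L) (Q : qform W) (j : V -> W) :
  {morph j : u v / u + v} -> (forall v, Q (j v) = (q v)%:A) ->
  forall x : 'rV[L]_(\dim {:V}), Q (\sum_i x 0 i *: j (e i)) = qf_ext q L x.
Proof.
move=> jD Qj x; pose y (i : nat) : L := odflt 0 (omap (x 0) (insub i)).
have yE (i : 'I__) : y i = x 0 i by rewrite /y valK.
have pj u v : polar Q (j u) (j v) = (polar q u v)%:A.
  by rewrite /polar -jD !Qj -!(in_algE L) -!rmorphB.
transitivity (Q (\sum_(i < \dim {:V}) y i *: j (e i))).
  by congr (Q _); apply: eq_bigr => i _; rewrite yE.
rewrite (qform_sum Q _ (fun i => j (e i))) /= mxE exchange_big /=.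
apply: eq_bigr => l _; rewrite !mxE mulr_suml; apply: eq_bigr => i _.
rewrite !mxE !yE; congr (_ * _ * _).
rewrite Qj pj -val_eqE /=.
by case: eqP => // _; case: ifP => // _; rewrite scale0r.
Qed.

(** The given isometry is extended L-linearly: [phi] extends [iota \o f] and [psi] extends [r \o g],
    where [iota] and [r] embed the K-rational vectors. Both are mutually inverse because they are so
    on the bases. *)
Lemma qf_ext_pfister2 (b c : K) :
  isometric q (pfister2 b c) -> isometric (qf_ext q L) (pfister2 (K := L) b%:A c%:A).
Proof.
move=> [f [[g fK gK] qf]].
pose gl : {linear _ -> V} :=
  HB.pack g (GRing.isLinear.Build _ _ _ _ g (can2_linear fK gK)).
pose W := ((L^o * L^o) * (L^o * L^o))%type.
pose iota (v : (K^o * K^o) * (K^o * K^o)) : W :=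
  ((v.1.1%:A, v.1.2%:A), (v.2.1%:A, v.2.2%:A)).
have iotaP k u v : iota (k *: u + v) = k%:A *: iota u + iota v.
  by congr (_, _, (_, _)); rewrite /= -!(in_algE L) rmorphD rmorphM.
pose r (v : V) : 'rV[L]_(\dim {:V}) := \row_i (coord (vbasis {:V}) i v)%:A.
have rP k u v : r (k *: u + v) = k%:A *: r u + r v.
  by apply/rowP => i; rewrite !mxE linearP /= -!(in_algE L) rmorphD rmorphM.
pose phi (x : 'rV[L]_(\dim {:V})) : W := \sum_i x 0 i *: iota (f (e i)).
pose e1 : (K^o * K^o) * (K^o * K^o) := ((1, 0), (0, 0)).
pose e2 : (K^o * K^o) * (K^o * K^o) := ((0, 1), (0, 0)).
pose e3 : (K^o * K^o) * (K^o * K^o) := ((0, 0), (1, 0)).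
pose e4 : (K^o * K^o) * (K^o * K^o) := ((0, 0), (0, 1)).
pose psi (y : W) := y.1.1 *: r (gl e1) + y.1.2 *: r (gl e2) +
  y.2.1 *: r (gl e3) + y.2.2 *: r (gl e4).
have psi_lin : linear psi.
  by move=> k y z; apply/rowP => i; rewrite !mxE /= /GRing.scale /=; ring.
have phi_lin : linear phi.
  move=> k y z; rewrite /phi scaler_sumr -big_split; apply: eq_bigr => i _.
  by rewrite !mxE scalerDl scalerA.
pose psil : {linear W -> 'rV[L]_(\dim {:V})} :=
  HB.pack psi (GRing.isLinear.Build _ _ _ _ psi psi_lin).
pose phil : {linear 'rV[L]_(\dim {:V}) -> W} :=
  HB.pack phi (GRing.isLinear.Build _ _ _ _ phi phi_lin).
have iotaD : {morph iota \o f : u v / u + v}.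
  move=> u v; rewrite /comp linearD -[X in iota (X + _) = _]scale1r iotaP.
  by rewrite !scale1r.
have iota0 : iota (f 0) = 0.
  by apply: (addrI (iota (f 0))); have := iotaD 0 0; rewrite /comp !addr0 => <-.
have iotaZ k w : iota (k *: w) = k%:A *: iota w.
  by rewrite -[k *: w]addr0 iotaP -[in iota 0](linear0 f) iota0 addr0.
have phi_r v : phi (r v) = iota (f v).
  rewrite [in RHS](coord_vbasis (memvf v)) /phi.
  rewrite -[RHS]/((iota \o f) _) (big_morph (iota \o f) iotaD iota0).
  apply: eq_bigr => i _.
  by rewrite mxE /comp linearZ iotaZ.
have r0 : r 0 = 0 by apply/rowP => i; rewrite !mxE linear0 scale0r.
have rZ k v : r (k *: v) = k%:A *: r v by rewrite -[k *: v]addr0 rP r0 addr0.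
have r_sum v : r v = psi (iota (f v)).
  rewrite -[in LHS](fK v) /psi /=.
  have -> : g (f v) = (f v).1.1 *: gl e1 + ((f v).1.2 *: gl e2 +
      ((f v).2.1 *: gl e3 + (f v).2.2 *: gl e4)).
    rewrite -!linearZ -!linearD /=; congr g.
    by case: (f v) => [[x y] [z w]]; congr (_, _, (_, _));
       rewrite /= /GRing.scale /=; ring.
  by rewrite !rP rZ !addrA.
have re (i : 'I_(\dim {:V})) : r (e i) = delta_mx 0 i.
  apply/rowP => j; rewrite !mxE coord_free; last exact: basis_free (vbasisP _).
  rewrite /= eq_sym.
  by case: eqP; rewrite ?scale1r ?scale0r.
apply: (isometric_can (f := phi) (g := psi)) => //.
- move=> x; rewrite -[phi x]/(\sum_i _) -[psi _]/(psil _) linear_sum.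
  rewrite [RHS]row_sum_delta; apply: eq_bigr => i _.
  by rewrite linearZ /= -r_sum re.
- case=> [[x y] [z w]]; rewrite -[phi _]/(phil _) /psi !linearD !linearZ /= !phi_r !gK.
  rewrite /iota /= !scale1r !scale0r.
  by congr (_, _, (_, _)); rewrite /= /GRing.scale /=; ring.
apply: (qf_ext_sum (Q := pfister2 b%:A c%:A) iotaD) => v /=.
by rewrite -qf /= -!(in_algE L) !(rmorphD, rmorphM, rmorphXn).
Qed.

(** The vector with [(1, 0)] in every plane is isotropic; without planes every value is an empty
    sum, and [w] itself serves. *)
Lemma hyperbolic_isotropic (W : vectType K) (Q : qform W) :
  hyperbolic Q -> (exists w : W, w != 0) -> exists2 w : W, w != 0 & Q w = 0.
Proof.
move=> [n /isometric_sym[g [bg qg]]] [w w0].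
case: n g bg qg => [|n] g bg qg.
  by exists w => //; have [h _ gK] := bg; rewrite -(gK w) qg /= big_ord0.
exists (g [ffun=> (1, 0)]); last first.
  by rewrite qg /=; apply: big1 => i _; rewrite ffunE mulr0.
rewrite -(raddf0 g) (inj_eq (bij_inj bg)); apply/eqP => /ffunP/(_ 0).
by rewrite !ffunE => -[/eqP]; rewrite oner_eq0.
Qed.

End ScalarExtension.

(** For [w = u + th v], the relation [th^2 = c - th] gives the value
    [(q u + c q v) + th (b(u, v) - q v)], with [b] the polar form; both coordinates must vanish. *)
Lemma qf_ext_isotropic (K : fieldType) (V : vectType K) (q : qform V)
    (L : fieldExtType K) (th : L) (c : K) :
  2%N \in [pchar K] -> th ^+ 2 + th = c%:A ->
  (forall w : L, exists u v : K, w = u%:A + th * v%:A) ->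
  (forall u v : K, u%:A + th * v%:A = 0 -> u = 0 /\ v = 0) ->
  (exists2 w, w != 0 & qf_ext q L w = 0) ->
  exists u v : V, [/\ (u != 0) || (v != 0), q v = polar q u v & q u = c * q v].
Proof.
move=> charK2 thE span_th free_th [w w0 qw0].
have [a wa] := fin_all_exists (fun i => span_th (w 0 i)).
have [b wb] := fin_all_exists wa.
pose A := \row_i a i; pose B := \row_i b i.
have wE : w = map_mx (in_alg L) A + th *: map_mx (in_alg L) B.
  by apply/rowP => i; rewrite !mxE wb.
pose vec (A : 'rV[K]_(\dim {:V})) := \sum_i A 0 i *: (vbasis {:V})`_i.
have vec_eq0 (C : 'rV[K]_(\dim {:V})) : vec C = 0 -> C = 0.
  move=> C0; apply/rowP => i; rewrite mxE.
  by have /freeP/(_ (C 0) C0 i) := basis_free (vbasisP {:V}).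
exists (vec A), (vec B).
have [eq1 eq2] : q (vec A) + c * q (vec B) = 0 /\
    polar q (vec A) (vec B) - q (vec B) = 0.
  apply: free_th; rewrite -[RHS]qw0 wE.
  have -> : qf_ext q L (map_mx (in_alg L) A + th *: map_mx (in_alg L) B) =
      qf_ext q L (map_mx (in_alg L) A) + qf_ext q L (th *: map_mx (in_alg L) B) +
      polar (qf_ext q L) (map_mx (in_alg L) A) (th *: map_mx (in_alg L) B).
    by rewrite /polar; ring.
  have -> : polar (qf_ext q L) (map_mx (in_alg L) A) (th *: map_mx (in_alg L) B) =
      th * polar (qf_ext q L) (map_mx (in_alg L) A) (map_mx (in_alg L) B).
    have := qf_polar (qf_ext q L) (map_mx (in_alg L) A) th (map_mx (in_alg L) B) 0.
    rewrite addr0 => ->.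
    (* This instance shows that the polar form vanishes at 0. *)
    have := qf_polar (qf_ext q L) (map_mx (in_alg L) A) (-1) 0 0.
    by rewrite scaleN1r oppr0 addr0 mulN1r addNr => ->; rewrite addr0.
  rewrite qfZ polar_qf_ext_map !qf_ext_map -/(vec A) -/(vec B).
  have -> : th ^+ 2 = c%:A - th by rewrite -thE addrK.
  by rewrite -!(in_algE L) rmorphD rmorphB rmorphM; ring.
split.
- apply: contra_neqT w0; rewrite negb_or !negbK => /andP[/eqP/vec_eq0 A0 /eqP/vec_eq0 B0].
  by rewrite wE A0 B0 !map_mx0 scaler0 addr0.
- by apply/esym/eqP; rewrite -subr_eq0 eq2.
- by apply/eqP; rewrite -(oppr_pchar2 charK2 (c * _)) -addr_eq0 eq1.
Qed.

(** * Comparison of lowest coefficients *)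

(** [1, c'] is the norm form of the field F(th') with [th'^2 + th' = c'], and its polar form is the
    trace of [u] times the conjugate of [v]. So [u / v] has trace 1 and norm [c]; trace 1 means
    [p + th'], whose norm is [p^2 + p + c']. *)
Lemma artin_schreier_norm_trace (F : fieldType) (c c' : F) (u v : F^o * F^o) :
  2%N \in [pchar F] -> (forall p, p ^+ 2 + p != c') ->
  binary_qf c' v = polar (binary_qf c') u v ->
  binary_qf c' u = c * binary_qf c' v ->
  (u != 0) || (v != 0) -> exists p, c = c' + (p ^+ 2 + p).
Proof.
move=> charF2 noroot; have two0 : 2%:R = 0 :> F := pcharf0 charF2.
have aniso (w : F^o * F^o) : binary_qf c' w = 0 -> w = 0.
  case: w => x y /=; have [->|y0] := eqVneq y 0.
    by rewrite mulr0 expr0n mulr0 !addr0 => /eqP; rewrite sqrf_eq0 => /eqP ->.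
  move=> N0; case/eqP: (noroot (x / y)); apply/eqP.
  rewrite -subr_eq0; apply/eqP; apply: (mulfI (expf_neq0 2 y0)).
  rewrite mulr0 -[RHS]N0 -[RHS]addr0 -(mul0r (- (c' * y ^+ 2))) -two0.
  by field.
move=> eq1 eq2 uv0.
have v0 : binary_qf c' v != 0.
  apply: contraTneq uv0 => v0; rewrite v0 mulr0 in eq2.
  by rewrite (aniso _ v0) (aniso _ eq2) eqxx.
case: u v eq1 eq2 v0 {uv0} => [x y] [z w]; set n := binary_qf c' (z, w) => eq1 eq2 n0.
have tr : x * w + y * z = n.
  rewrite eq1 /polar /= -[LHS]addr0 -(mul0r (x * z + c' * y * w)) -two0.
  by ring.
(* [u] times the conjugate of [v] equals [s + n th']; dividing by the norm [n] of [v] gives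
   [p = s / n]. *)
pose s := x * z + x * w + c' * y * w; exists (s / n).
apply: (mulfI (expf_neq0 2 n0)); transitivity (binary_qf c' (x, y) * n).
  by rewrite eq2; ring.
transitivity (s ^+ 2 + s * n + c' * n ^+ 2); last by field.
(* Multiplicativity of the norm form on [u] and the conjugate of [v]. *)
rewrite /n in tr *; rewrite -{2 3}tr /s -[LHS]addr0.
rewrite -(mul0r (x ^+ 2 * w ^+ 2 + x ^+ 2 * z * w +
  c' * x * y * z * w *+ 2 + c' * x * y * w ^+ 2)) -two0 /=.
by ring.
Qed.

Section LaurentPairs.
Variable F : fieldType.
Implicit Types (u v : (laurent F)^o * (laurent F)^o) (k : int).

Definition pair_vanishes u k := vanishes_below (u.1 : laurent F) k /\
  vanishes_below (u.2 : laurent F) k.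

Definition pair_coef u k : F^o * F^o := ((u.1 : laurent F) k, (u.2 : laurent F) k).

Lemma pair_vanishesS u k :
  pair_vanishes u k -> pair_coef u k = 0 -> pair_vanishes u (k + 1).
Proof.
move=> [u1 u2] [e1 e2]; split=> i ik.
  by have [->//|ne] := eqVneq i k; apply: u1; lia.
by have [->//|ne] := eqVneq i k; apply: u2; lia.
Qed.

Lemma pair_vanishes_leq u k l : k <= l -> pair_vanishes u l -> pair_vanishes u k.
Proof. by move=> kl [u1 u2]; split; exact: vanishes_below_leq kl _. Qed.

Lemma pair_vanishesD u v k :
  pair_vanishes u k -> pair_vanishes v k -> pair_vanishes (u + v) k.
Proof.
move=> [u1 u2] [v1 v2]; split=> i ik.
  change ((u.1 : laurent F) i + (v.1 : laurent F) i = 0).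
  by rewrite u1 // v1 // addr0.
change ((u.2 : laurent F) i + (v.2 : laurent F) i = 0).
by rewrite u2 // v2 // addr0.
Qed.

Lemma laurent_coefD (f g : laurent F) k : (f + g) k = f k + g k.
Proof. by []. Qed.

Lemma laurent_coefB (f g : laurent F) k : (f - g) k = f k - g k.
Proof. by []. Qed.

Lemma binary_qf_vanishes (c : F) u k : pair_vanishes u k ->
  vanishes_below (binary_qf (monomial c 0) u) (k + k).
Proof.
move=> [u1 u2] i ik.
change ((u.1 ^+ 2 + u.1 * u.2 + monomial c 0 * u.2 ^+ 2 : laurent F) i = 0).
rewrite !laurent_coefD coef_monomialM subr0 !expr2 !(vanishes_belowM _ _ ik) //.
by rewrite mulr0 !addr0.
Qed.

(** Lowest coefficients multiply, and the constant [c] does not shift degrees. *)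
Lemma coef_binary_qf (c : F) u k : pair_vanishes u k ->
  (binary_qf (monomial c 0) u : laurent F) (k + k) = binary_qf c (pair_coef u k).
Proof.
move=> [u1 u2].
change ((u.1 ^+ 2 + u.1 * u.2 + monomial c 0 * u.2 ^+ 2 : laurent F) (k + k) =
  binary_qf c (pair_coef u k)).
by rewrite !laurent_coefD coef_monomialM subr0 !expr2 !coefM_low //= !expr2.
Qed.

Lemma polar_binary_qf_vanishes (c : F) u v k : pair_vanishes u k -> pair_vanishes v k ->
  vanishes_below (polar (binary_qf (monomial c 0)) u v) (k + k).
Proof.
move=> uk vk i ik; rewrite /polar !laurent_coefB.
rewrite !(binary_qf_vanishes _ _ ik) ?subr0 //; exact: pair_vanishesD.
Qed.

Lemma coef_polar_binary_qf (c : F) u v k : pair_vanishes u k -> pair_vanishes v k ->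
  (polar (binary_qf (monomial c 0)) u v : laurent F) (k + k) =
  polar (binary_qf c) (pair_coef u k) (pair_coef v k).
Proof.
move=> uk vk; rewrite /polar !laurent_coefB !coef_binary_qf //.
exact: pair_vanishesD.
Qed.

Lemma pair_vanishes_eq0 u : (forall k, pair_vanishes u k) -> u = 0.
Proof.
case: u => x y uk; congr (_, _); apply: laurentP => i.
  by case: (uk (i + 1)) => + _; apply; lia.
by case: (uk (i + 1)) => _; apply; lia.
Qed.

Lemma pair_vanishes_ex u : exists a : nat, forall b : nat, (a <= b)%N ->
  pair_vanishes u (- b%:Z).
Proof.
have [a ua] := laurent_bound (u.1 : laurent F).
have [b ub] := laurent_bound (u.2 : laurent F).
by exists (maxn a b) => m abm; split; [apply: ua | apply: ub]; lia.
Qed.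

End LaurentPairs.

Lemma polar_orth_sum_scale (K : fieldType) (V W : vectType K) (q : qform V)
    (q' : qform W) (b : K) (u v : V * W) :
  polar (orth_sum q (qscale b q')) u v = polar q u.1 v.1 + b * polar q' u.2 v.2.
Proof. by rewrite /polar /=; ring. Qed.

(** * Descent on the order of vanishing *)

Section Descent.
Variables (F : fieldType) (c c' : F).
Hypotheses (charF2 : 2%N \in [pchar F]) (noroot : forall p, p ^+ 2 + p != c').
Local Notation K := (laurent F).
Local Notation N := (binary_qf (monomial c' 0)).
Local Notation t := (monomial (1 : F) 1).

(** If no [p] exists, the lowest coefficients of [u] and [v] solve the equations over F only
    trivially. The order of vanishing thus rises forever, alternately in the two summands, and
    [u = v = 0]. *)
Lemma pfister2_linked_constant (u v : (K^o * K^o) * (K^o * K^o)) :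
  let Q := pfister2 t (monomial c' 0) in
  (u != 0) || (v != 0) -> Q v = polar Q u v -> Q u = monomial c 0 * Q v ->
  exists p, c = c' + (p ^+ 2 + p).
Proof.
move=> Q uv0 eq1 eq2; apply: contrapT => nop.
have QE w : Q w = N w.1 + t * N w.2 by [].
have polE : polar Q u v = polar N u.1 v.1 + t * polar N u.2 v.2.
  exact: polar_orth_sum_scale.
pose P k l := [/\ pair_vanishes u.1 k, pair_vanishes v.1 k, pair_vanishes u.2 l &
  pair_vanishes v.2 l].
have no_coef (x y : F^o * F^o) : binary_qf c' y = polar (binary_qf c') x y ->
    binary_qf c' x = c * binary_qf c' y -> x = 0 /\ y = 0.
  move=> e1 e2; have := contra_not (artin_schreier_norm_trace charF2 noroot e1 e2) nop.
  by move/negP; rewrite negb_or !negbK => /andP[/eqP-> /eqP->].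
(* The coefficient of index 2k only sees the summand [1, c'], that of index
   2k + 1 only the summand t [1, c']. *)
have step1 k : P k k -> P (k + 1) k.
  move=> [u1 v1 u2 v2].
  have low (f g : K) : vanishes_below g (k + k) -> (f + t * g) (k + k) = f (k + k).
    by move=> gk; rewrite laurent_coefD coef_monomialM gk ?mulr0 ?addr0 //; lia.
  have [||x0 y0] := no_coef (pair_coef u.1 k) (pair_coef v.1 k).
  - rewrite -coef_polar_binary_qf // -coef_binary_qf //.
    move: eq1 => /(congr1 (fun f : K => f (k + k))).
    by rewrite polE QE (low _ _ (binary_qf_vanishes c' v2))
      (low _ _ (polar_binary_qf_vanishes c' u2 v2)).
  - rewrite -!coef_binary_qf //.
    move: eq2 => /(congr1 (fun f : K => f (k + k))).
    by rewrite coef_monomialM subr0 !QE (low _ _ (binary_qf_vanishes c' u2))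
      (low _ _ (binary_qf_vanishes c' v2)).
  by split=> //; exact: pair_vanishesS.
have step2 k : P (k + 1) k -> P (k + 1) (k + 1).
  move=> [u1 v1 u2 v2].
  (* The first summand now starts at index [2k + 2], and t shifts the second by one. *)
  have low (f g : K) : vanishes_below f (k + 1 + (k + 1)) ->
      (f + t * g) (k + k + 1) = g (k + k).
    move=> fk; rewrite laurent_coefD coef_monomialM mul1r addrK fk ?add0r //; lia.
  have [||x0 y0] := no_coef (pair_coef u.2 k) (pair_coef v.2 k).
  - rewrite -coef_polar_binary_qf // -coef_binary_qf //.
    move: eq1 => /(congr1 (fun f : K => f (k + k + 1))).
    by rewrite polE QE (low _ _ (binary_qf_vanishes c' v1))
      (low _ _ (polar_binary_qf_vanishes c' u1 v1)).
  - rewrite -!coef_binary_qf //.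
    move: eq2 => /(congr1 (fun f : K => f (k + k + 1))).
    by rewrite coef_monomialM subr0 !QE (low _ _ (binary_qf_vanishes c' u1))
      (low _ _ (binary_qf_vanishes c' v1)).
  by split=> //; exact: pair_vanishesS.
have [a1 ua1] := pair_vanishes_ex u.1; have [a2 ua2] := pair_vanishes_ex u.2.
have [b1 vb1] := pair_vanishes_ex v.1; have [b2 vb2] := pair_vanishes_ex v.2.
pose m := (a1 + a2 + b1 + b2)%N.
have Pall (j : nat) : P (j%:Z - m%:Z) (j%:Z - m%:Z).
  elim: j => [|j IHj].
    rewrite sub0r; split; [apply: ua1|apply: vb1|apply: ua2|apply: vb2];
      by rewrite /m; lia.
  have -> : j.+1%:Z - m%:Z = j%:Z - m%:Z + 1 by lia.
  exact/step2/step1.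
have Pk k : P k k.
  have le_k : k <= `|(k + m%:Z)%R|%N%:Z - m%:Z by lia.
  by case: (Pall `|(k + m%:Z)%R|%N); split; exact: pair_vanishes_leq le_k _.
have u0 : u = 0.
  rewrite [u]surjective_pairing; congr (_, _); apply: pair_vanishes_eq0 => k;
    by case: (Pk k).
have v0 : v = 0.
  rewrite [v]surjective_pairing; congr (_, _); apply: pair_vanishes_eq0 => k;
    by case: (Pk k).
by rewrite u0 v0 eqxx in uv0.
Qed.

End Descent.

(** * From a common splitting field to an isometry *)

Unset Implicit Arguments.

Theorem corollary6p9 (F : fieldType) (charF2 : 2%N \in [pchar F])
    (perfF : perfect_field F) (V V' : vectType (laurent F))
    (pi : qform V) (pi' : qform V') :
  is_pfister2 pi -> is_pfister2 pi' -> anisotropic pi -> anisotropic pi' ->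
  totally_separably_linked pi pi' -> isometric pi pi'.
Proof.
move=> pfpi pfpi' api api' linked.
have charK2 := laurent_pchar2 charF2.
have [c piE] := pfister2_constant_form charF2 perfF pfpi api.
have [c' piE'] := pfister2_constant_form charF2 perfF pfpi' api'.
have aniso := isometric_anisotropic piE api.
have aniso' := isometric_anisotropic piE' api'.
have t0 : monomial (1 : F) 1 != 0 by rewrite monomial_neq0 ?oner_neq0.
have noroot x : x ^+ 2 + x != monomial c 0 := pfister2_anisotropic_noroot charK2 aniso x.
(* A root in F would be a constant root in K. *)
have noroot' p : p ^+ 2 + p != c'.
  have := pfister2_anisotropic_noroot charK2 aniso' (monomial p 0).
  apply: contra_neq => <-; rewrite -monomial0X2; apply: laurentP => i /=.
  by case: ifP; rewrite ?addr0.
have [L [th [dimL sepL thE span_th free_th]]] := artin_schreier_extension charK2 noroot.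
have hypL : hyperbolic (qf_ext pi L).
  have [n isoL] : hyperbolic
      (pfister2 (K := L) (monomial 1 1)%:A (monomial c 0)%:A).
    rewrite -thE; apply: pfister2_hyperbolic; last by rewrite scaler_eq0 oner_eq0 orbF.
    exact: rmorph_pchar (in_alg L) _ charK2.
  exists n; exact: isometric_trans (qf_ext_pfister2 L piE) isoL.
have [|w w0 piw] := hyperbolic_isotropic ((linked L dimL sepL).1 hypL).
  (* This vector is zero only in dimension 0, but [V'] is isomorphic to the nonzero space of a
     Pfister form. *)
  exists (const_mx 1); apply/eqP => /matrixP one0.
  have [f [[g fK gK] _]] := piE'.
  have dim0 : \dim {:V'} = 0%N.
    by case: (\dim _) one0 => // n /(_ 0 0) /eqP; rewrite !mxE oner_eq0.
  have V0 v : v = 0 :> V'.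
    by apply/eqP; rewrite -memv0 -(eqP (_ : {:V'} == 0)%VS) ?memvf // -dimv_eq0 dim0.
  have := f_equal f (V0 (g ((1, 0), (0, 0)))).
  rewrite gK raddf0 => /(congr1 (fun x => x.1.1))/= /eqP.
  by rewrite oner_eq0.
have [u [v [uv0 eq1 eq2]]] := qf_ext_isotropic charK2 thE span_th free_th
  (ex_intro2 _ _ w w0 piw).
have [f [bf qf]] := piE'.
have [p cE] : exists p, c = c' + (p ^+ 2 + p).
  apply: (pfister2_linked_constant charF2 noroot' (u := f u) (v := f v)).
  - by rewrite -!(raddf0 f) !(inj_eq (bij_inj bf)).
  - by rewrite (isometric_polar qf) qf.
  - by rewrite !qf.
apply: isometric_trans piE _; apply: isometric_trans (isometric_sym piE').
have := pfister2_add_artin_schreier charK2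
  (monomial 1 1) (monomial c' 0) (monomial p 0) 0.
rewrite expr0n mulr0 addr0 -monomial0X2.
suff -> : monomial c' 0 + (monomial (p ^+ 2) 0 + monomial p 0) = monomial c 0 by [].
by apply: laurentP => i /=; case: ifP; rewrite ?addr0 // cE.
Qed.
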